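(* (Correctness of the MO algorithm.) Let $\mathbb{D}=\langle (E_1,t_1),\ldots,(E_n,t_n)\rangle$ be an event sequence with $t_1<\cdots<t_n$ and let $\alpha$ be an $N$-node serial episode. Then the frequency returned by the MO algorithm run on $\mathbb{D}$ for $\alpha$ equals the minimal-occurrences-based frequency of $\alpha$ in $\mathbb{D}$, i.e. the number of minimal windows of $\alpha$ in $\mathbb{D}$.
   Context: An event sequence is $\mathbb{D}=\langle (E_1,t_1),\ldots,(E_n,t_n)\rangle$, where each event-type $E_i$ belongs to a finite alphabet and each $t_i$ is a positive integer. An $N$-node serial episode is a sequence of event-types $\alpha=(\alpha[1]\to\cdots\to\alpha[N])$ with nodes $v_1,\ldots,v_N$. An occurrence of $\alpha$ in $\mathbb{D}$ is a map $h:\{v_1,\ldots,v_N\}\to\{1,\ldots,n\}$ with $E_{h(v_i)}=\alpha[i]$ for all $i$ and $t_{h(v_1)}<\cdots<t_{h(v_N)}$. The time-window of $h$ is $[t_{h(v_1)},t_{h(v_N)}]$. A minimal window of $\alpha$ is a time-window containing an occurrence of $\alpha$ such that no proper sub-window of it contains an occurrence of $\alpha$. Automata. An automaton for $\alpha$ has states $0,1,\ldots,N$; in state $j<N$ it waits for an event of type $\alpha[j+1]$, and on accepting such an event it moves to state $j+1$. State $0$ is the start state and state $N$ the final state. The MO algorithm. Initially there is one automaton, in state $0$, and the frequency is $0$. The events are processed in time order. When event $(E_l,t_l)$ is processed: (1) every automaton present before this event and waiting for event-type $E_l$ accepts it and moves to its next state (each automaton makes at most one transition per event); whenever an automaton leaves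 state $0$, a new automaton is placed in state $0$ (it does not process the current event); (2) if, as a result, an automaton has moved into a state $j$ with $0<j<N$ in which an automaton initialized earlier is still present (that one did not move on this event), the earlier-initialized automaton is removed; (3) if an automaton has reached state $N$, the frequency is incremented by $1$ and that automaton is removed (all other automata are kept). The frequency after all events are processed is returned. *)

(* Defs.v *)
From mathcomp Require Import all_boot finmap.
From mathcomp Require Import boolp classical_sets functions cardinality.

Set Implicit Arguments.
Unset Strict Implicit.
Unset Printing Implicit Defensive.

Local Open Scope classical_set_scope.

(* <(E_1, t_1), ..., (E_n, t_n)>; positivity of the t_i is imposed separately. *)
Definition event_seq (A : finType) (n : nat) := n.-tuple (A * nat).

(* alpha[1] -> ... -> alpha[N]; nodes are numbered from 0, so alpha[j+1] is
   the entry of index j. *)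
Definition serial_episode (A : finType) (N : nat) := N.-tuple A.

Definition event_type (A : finType) n (D : event_seq A n) (i : 'I_n) : A :=
  (tnth D i).1.

Definition time (A : finType) n (D : event_seq A n) (i : 'I_n) : nat :=
  (tnth D i).2.

Section MinimalWindows.
Variables (A : finType) (n N : nat).
Variables (alpha : serial_episode A N.+1) (D : event_seq A n).

Definition occurrence (h : {ffun 'I_N.+1 -> 'I_n}) : Prop :=
  (forall i, event_type D (h i) = tnth alpha i) /\
  (forall i j : 'I_N.+1, i < j -> time D (h i) < time D (h j)).

(* The window [a, b] is encoded as the pair (a, b).  Pairs with b < a are
   harmless: they contain no occurrence. *)
Definition time_window (h : {ffun 'I_N.+1 -> 'I_n}) : nat * nat :=
  (time D (h ord0), time D (h ord_max)).

Definition subwindow (w' w : nat * nat) : Prop := w.1 <= w'.1 /\ w'.2 <= w.2.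

Definition proper_subwindow (w' w : nat * nat) : Prop :=
  subwindow w' w /\ w' <> w.

Definition contains_occurrence (w : nat * nat) : Prop :=
  exists h, occurrence h /\ subwindow (time_window h) w.

Definition minimal_window (w : nat * nat) : Prop :=
  contains_occurrence w /\
  (forall w', proper_subwindow w' w -> ~ contains_occurrence w').

(* [fset_set] is meaningful only on finite sets. *)
Lemma finite_minimal_windows : finite_set [set w | minimal_window w].
Proof.
apply: (@sub_finite_set _ _ (time_window @` [set: {ffun 'I_N.+1 -> 'I_n}])).
  move=> w /= [[h [hocc hw]] wmin]; exists h => //.
  apply: contrapT => neq; apply: (wmin (time_window h)); first by split.
  by exists h; split => //; split.
exact/finite_image/finite_finset.
Qed.

Definition minimal_occurrence_frequency : nat :=
  #|` fset_set [set w | minimal_window w] |.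

End MinimalWindows.

Section MOAlgorithm.
Variables (A : finType) (N : nat) (alpha : serial_episode A N).

(* Holds iff j < N and alpha[j+1] = E. *)
Definition waits_for (j : nat) (E : A) : bool := onth alpha j == Some E.

(* In all lists of automata below, automata are in order of initialization,
   the earliest first.  During the processing of an event, an automaton is a
   pair (current state, did it move on this event). *)

Definition transition (E : A) (autos : seq nat) : seq (nat * bool) :=
  [seq if waits_for j E then (j.+1, true) else (j, false) | j <- autos]
  ++ [seq (0, false) | j <- autos & (j == 0) && waits_for j E].

Fixpoint remove_superseded (autos : seq (nat * bool)) : seq (nat * bool) :=
  if autos is (j, moved) :: later then
    if [&& ~~ moved, 0 < j < N & (j, true) \in later]
    then remove_superseded later
    else (j, moved) :: remove_superseded later
  else [::].

(* A configuration is the list of states of the automata together with the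
   current frequency. *)
Definition MO_step (c : seq nat * nat) (e : A * nat) : seq nat * nat :=
  let states := [seq a.1 | a <- remove_superseded (transition e.1 c.1)] in
  ([seq j <- states | j != N], c.2 + count_mem N states).

Definition MO n (D : event_seq A n) : nat := (foldl MO_step ([:: 0], 0) D).2.

End MOAlgorithm.

(* Main.v *)
(* The automaton placed in state 0 before event i reads greedily, so that it
   reaches N exactly when alpha is a subsequence of the events read since i.
   Superseded automata are duplicates of later ones, hence before event l the
   occupied states are those reached from all starting points i <= l, each
   occupied once, except N.  Therefore the frequency counts the events l for
   which some i <= l has an occurrence of alpha in [i, l] but none in [i, l).
   For the latest i with an occurrence in [i, l], the window [t_i, t_l] is then
   minimal; conversely every minimal window arises in this way, and it is
   determined by its right end. *)

Require Import Defs.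
From mathcomp Require Import all_boot finmap.
From mathcomp Require Import boolp classical_sets cardinality.
From mathcomp Require Import zify.

Set Implicit Arguments.
Unset Strict Implicit.
Unset Printing Implicit Defensive.

(** * Greedy reading of events and the states of the algorithm *)

Section Algorithm.
Variables (A : finType) (N : nat) (alpha : serial_episode A N).
Implicit Types (E : A) (e : A * nat) (s : seq (A * nat)) (c : seq nat).

Definition advance j e := if waits_for alpha j e.1 then j.+1 else j.

Definition run s := foldl advance 0 s.

Definition infix_word T (s : seq T) i l := drop i (take l s).

(** The index i = l stands for the automaton just placed in state 0, which has read nothing.
    Repeated states and the state N still occur here, unlike in a configuration. *)
Definition run_states s l := [seq run (infix_word s i l) | i <- iota 0 l.+1].

Lemma infix_word_nil T (s : seq T) l : infix_word s l l = [::].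
Proof. by rewrite /infix_word drop_oversize // size_take; case: ltnP. Qed.

Lemma infix_wordS T (x0 : T) (s : seq T) i l : i <= l -> l < size s ->
  infix_word s i l.+1 = rcons (infix_word s i l) (nth x0 s l).
Proof.
move=> il ls; rewrite /infix_word (take_nth x0) // drop_rcons // size_take.
by case: ifP => //; lia.
Qed.

Lemma run_statesS e0 s l : l < size s ->
  run_states s l.+1 =
  rcons [seq advance j (nth e0 s l) | j <- run_states s l] 0.
Proof.
move=> ls; rewrite /run_states -[l.+2]addn1 iotaD map_cat add0n cats1.
rewrite infix_word_nil; congr (rcons _ 0); rewrite -map_comp; apply/eq_in_map => i; rewrite mem_iota => /andP[_ il] /=.
by rewrite (infix_wordS e0) // /run foldl_rcons.
Qed.

(** Greedy matching is the recursion by which [subseq] computes, so induction on [s] with a general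
    start state suffices. At j = N the remaining word is empty and the state no longer changes. *)
Lemma foldl_advance_subseq s j : j <= N ->
  (foldl advance j s == N) = subseq (drop j alpha) (map fst s).
Proof.
elim: s j => [|e s IH] j jN /=.
  by rewrite -size_eq0 size_drop size_tuple subn_eq0 eqn_leq jN.
case: (ltnP j N) => jlt; last first.
  have dropnil k : N <= k -> drop k alpha = [::].
    by move=> kN; rewrite drop_oversize // size_tuple.
  have -> : advance j e = j by rewrite /advance /waits_for onth_default ?size_tuple.
  by rewrite IH // !dropnil // sub0seq.
pose x0 := tnth alpha (Ordinal jlt).
rewrite [advance j e]/advance /waits_for (drop_nth x0) ?size_tuple //=.
case nthE : (onth alpha j) => [a|]; last first.
  by have := onthTE alpha j; rewrite nthE size_tuple jlt.
rewrite (onth_nth x0 _ _ _ nthE) (inj_eq (@Some_inj _)).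
case: (a =P e.1) => _; rewrite IH //.
by rewrite (drop_nth x0) ?size_tuple // (onth_nth x0 _ _ _ nthE).
Qed.

(* How x may be followed by y in a transition: an automaton is never overtaken
   by a later one, which reaches its state only by moving while it stays.  This
   makes the rule of [remove_superseded] keep the last copy of each state, as
   [undup] does. *)
Definition caught_up (x y : nat * bool) :=
  (y.1 <= x.1) && ((y.1 == x.1) ==> [&& ~~ x.2, y.2 & 0 < x.1 < N]).

Lemma remove_superseded_undup t : pairwise caught_up t ->
  [seq a.1 | a <- remove_superseded N t] = undup [seq a.1 | a <- t].
Proof.
elim: t => [|[j m] t IH] //= /andP[/allP catch /IH {}IH].
have -> : [&& ~~ m, 0 < j < N & (j, true) \in t] = (j \in [seq a.1 | a <- t]).
  apply/and3P/mapP => [[_ _ jt]|[[k b] kt /= jk]]; first by exists (j, true).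
  have := catch _ kt; rewrite /caught_up /= jk leqnn eqxx /= => /and3P[-> bT ->].
  by case: b bT kt.
by case: ifP => //= _; rewrite IH.
Qed.

Lemma waits_for_lt j E : waits_for alpha j E -> j < N.
Proof.
rewrite ltnNge => w; apply/negP => jN.
by move: w; rewrite /waits_for onth_default ?size_tuple.
Qed.

(** A state grows by at most one, so in a strictly decreasing list a later automaton can at most
    tie, by moving while the earlier one stays. A new automaton never ties in state 0, since it
    appears only when that state is left. *)
Lemma pairwise_transition E c : sorted gtn c -> all (ltn^~ N) c ->
  pairwise caught_up (transition alpha E c).
Proof.
rewrite sorted_pairwise; last by move=> x y z /=; lia.
move=> cdec cN; rewrite /transition pairwise_cat !pairwise_map; apply/and3P; split.
- apply/allrelP => _ _ /mapP[j jc ->] /mapP[k + ->].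
  rewrite mem_filter => /andP[/andP[/eqP-> w] _].
  rewrite /caught_up /=; case: ifP => //=; case: j {jc} => [|j] //.
  by rewrite w.
- have := @sub_in_pairwise _ (ltn^~ N) _ _ _ c cN cdec; apply.
  rewrite /caught_up => j k; rewrite !unfold_in /= => jN kN kj.
  by do 2 case: ifP => _ /=; apply/andP; split; try lia; apply/implyP; lia.
(* Strict decrease allows only one automaton in state 0, hence at most one new one. *)
- have := @sub_in_pairwise _ (pred1 0) gtn; apply.
  + by move=> j k /eqP-> /eqP->.
  + by apply/allP => j; rewrite mem_filter => /andP[/andP[]].
  + exact: (subseq_pairwise (filter_subseq _ _)).
Qed.
 
(** State 0 stays occupied in either case: its automaton stays, or leaves and is replaced. *)
Lemma mem_transition e c : 0 \in c ->
  [seq a.1 | a <- transition alpha e.1 c] =i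
  rcons [seq advance j e | j <- c] 0.
Proof.
move=> c0 k; rewrite mem_rcons inE /transition map_cat mem_cat.
have -> : [seq a.1 | a <- [seq if waits_for alpha j e.1 then (j.+1, true)
                                 else (j, false) | j <- c]]
          = [seq advance j e | j <- c].
  by rewrite -map_comp; apply: eq_map => j; rewrite /advance /=; case: ifP.
rewrite -map_comp; case: (boolP (waits_for alpha 0 e.1)) => w.
- rewrite orbC; congr orb; apply/mapP/eqP => [[j _ ->] //|->].
  by exists 0; rewrite // mem_filter w c0.
- rewrite [X in _ || X](_ : _ = false) ?orbF; last first.
    apply/negbTE/mapP => -[j]; rewrite mem_filter => /andP[/andP[/eqP->]].
    by rewrite (negPf w).
  case: eqP => // ->; apply/mapP; exists 0 => //.
  by rewrite /advance (negPf w).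
Qed.

Lemma run_le s : run s <= N.
Proof.
rewrite /run; elim/last_ind: s => [|s e IH] //=; rewrite foldl_rcons /advance.
by case: ifP => // /waits_for_lt.
Qed.

(** A boolean and not a count: starting points that complete at the same event were all in state
    N-1, which the algorithm represents by a single automaton. *)
Definition completes s l :=
  has (fun i => (run (infix_word s i l) != N) && (run (infix_word s i l.+1) == N))
    (iota 0 l.+1).

Lemma completesE e0 s l : l < size s ->
  completes s l =
  has (fun j => (j != N) && (advance j (nth e0 s l) == N)) (run_states s l).
Proof.
move=> ls; rewrite has_map; apply: eq_in_has => i; rewrite mem_iota => /andP[_ il].
by rewrite /= (infix_wordS e0) // /run foldl_rcons.
Qed.

Lemma MO_invariant s l : 0 < N -> l <= size s ->
  let: (c, f) := foldl (MO_step alpha) ([:: 0], 0) (take l s) in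
  [/\ sorted gtn c, c =i [pred j | j != N & j \in run_states s l]
    & f = \sum_(m < l) completes s m].
Proof.
move=> N0; elim: l => [|l IH] ls.
  rewrite take0 /=; split=> //; last by rewrite big_ord0.
  move=> j; rewrite !inE /run /infix_word take0 /=.
  by case: eqP => [->|]; rewrite ?andbF // andbT neq_ltn N0.
have e0 : A * nat by case: (s) ls => [|e].
rewrite (take_nth e0) // foldl_rcons; have := IH (ltnW ls).
case: foldl => c f [cdec cE fE]; rewrite /MO_step /=.
set e := nth e0 s l.
have cN : all (ltn^~ N) c.
  apply/allP => j; rewrite cE inE => /andP[jN /mapP[i _ ji]].
  by rewrite /= ltn_neqAle jN ji run_le.
have c0 : 0 \in c.
  rewrite cE inE neq_ltn N0 /=; apply/mapP; exists l; first by rewrite mem_iota; lia.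
  by rewrite infix_word_nil.
have tr := pairwise_transition e.1 cdec cN.
rewrite (remove_superseded_undup tr); set st := undup _.
have stE : st =i rcons [seq advance j e | j <- c] 0.
  by move=> j; rewrite mem_undup mem_transition.
have st_dec : sorted gtn st.
  rewrite gtn_sorted_uniq_geq undup_uniq undup_sorted //; first by move=> x y z /=; lia.
  apply: pairwise_sorted; rewrite pairwise_map; apply: sub_pairwise tr.
  by move=> x y /andP[].
split.
- by apply: sorted_filter st_dec => x y z /=; lia.
- move=> j; rewrite mem_filter stE inE (run_statesS e0) // !mem_rcons 2!in_cons.
  case: (eqVneq j N) => [//|jN]; congr (_ || _).
  apply/mapP/mapP => -[k + jE]; first by rewrite cE => /andP[_]; exists k.
  (* Deleting automata in state N loses nothing: N leads only to N, which is excluded here. *)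
  move=> kS; exists k => //; rewrite cE inE kS andbT.
  apply: contra_neq jN => kN; rewrite jE kN /advance.
  by case: ifP => // /waits_for_lt; rewrite ltnn.
(* [st] has no duplicates, so N is counted at most once; the fresh state 0 differs from N as N is
   positive. *)
- rewrite big_ord_recr -fE (completesE e0 ls) count_uniq_mem ?undup_uniq // stE.
  congr (_ + nat_of_bool _); rewrite mem_rcons in_cons (gtn_eqF N0) orFb.
  apply/mapP/hasP => [[j]|[j jS /andP[jN /eqP jE]]].
    by rewrite cE => /andP[jN jS] jE; exists j; rewrite // jN -jE eqxx.
  by exists j; rewrite // cE inE jN.
Qed.

Lemma MO_sum_completes n (D : event_seq A n) : 0 < N ->
  MO alpha D = \sum_(l < n) completes D l.
Proof.
move=> N0; have := MO_invariant N0 (leqnn (size D)).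
by rewrite take_size /MO; case: foldl => c f [_ _ ->] /=; rewrite size_tuple.
Qed.

Lemma completes_subseq n (D : event_seq A n) (l : 'I_n) :
  completes D l = [exists i : 'I_n, [&& i <= l,
     ~~ subseq alpha (map fst (infix_word D i l))
   & subseq alpha (map fst (infix_word D i l.+1))]].
Proof.
have runE s : (run s == N) = subseq alpha (map fst s).
  by rewrite foldl_advance_subseq // drop0.
apply/hasP/existsP => [[i]|[i /and3P[il Ni Yi]]].
  rewrite mem_iota /= !runE => il /andP[Ni Yi].
  have lt_in : i < n by have := ltn_ord l; lia.
  exists (Ordinal lt_in); apply/and3P; split=> //=; exact: il.
by exists (i : nat); rewrite ?mem_iota // !runE Ni.
Qed.

End Algorithm.

(** * Minimal windows and the events that end them *)

Lemma sorted_enum_ord n : sorted (fun j k : 'I_n => j < k) (enum 'I_n).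
Proof. by have := iota_ltn_sorted 0 n; rewrite -val_enum_ord sorted_map. Qed.

Section Windows.
Variables (A : finType) (n N : nat).
Variables (alpha : serial_episode A N.+1) (D : event_seq A n).
Hypothesis time_incr : forall i j : 'I_n, i < j -> time D i < time D j.

Lemma time_mono (i j : 'I_n) : (time D i <= time D j) = (i <= j).
Proof.
case: (ltngtP i j) => [/time_incr/ltnW //|/time_incr|/val_inj->]; last exact: leqnn.
by move=> tji; rewrite leqNgt tji.
Qed.

Lemma mem_infix_enum (k : 'I_n) i l : (k \in infix_word (enum 'I_n) i l) = (i <= k < l).
Proof.
rewrite -(mem_map val_inj) /infix_word map_drop map_take val_enum_ord.
by rewrite take_iota drop_iota mem_iota /=; have := ltn_ord k; lia.
Qed.

Lemma sorted_infix_enum i l : sorted (fun j k : 'I_n => j < k) (infix_word (enum 'I_n) i l).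
Proof.
exact/drop_sorted/take_sorted/sorted_enum_ord.
Qed.

Lemma map_fst_infix i l :
  map fst (infix_word D i l) = map (event_type D) (infix_word (enum 'I_n) i l).
Proof.
by rewrite /infix_word -[in LHS](map_tnth_enum D) -map_take -map_drop -map_comp.
Qed.

(** A mask of the index list selects increasing indices, hence increasing times, which gives an
    occurrence; conversely the values of an occurrence form such a selection. *)
Lemma subseq_occurrence i l :
  subseq alpha (map fst (infix_word D i l)) <->
  exists h, [/\ occurrence alpha D h, i <= h ord0 & h ord_max < l].
Proof.
rewrite map_fst_infix; set w := infix_word _ i l.
have ord_trans : transitive (fun j k : 'I_n => j < k) by move=> ? ? ?; apply: ltn_trans.
split=> [/subseqP[m _]|[h [[hE hlt] ih hl]]].
  rewrite -map_mask => alphaE.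
  have ss : subseq (mask m w) w by apply: mask_subseq.
  move: (mask m w) alphaE ss => js alphaE ss.
  have js_lt : pairwise (fun j k : 'I_n => j < k) js.
    by apply: subseq_pairwise ss _; rewrite -sorted_pairwise // sorted_infix_enum.
  have js_sz : size js = N.+1 by rewrite -(size_map (event_type D)) -alphaE size_tuple.
  have k0 : 'I_n by case: (js) js_sz.
  have jsw (j : 'I_N.+1) : i <= nth k0 js j < l.
    by rewrite -mem_infix_enum (mem_subseq ss) // mem_nth ?js_sz.
  exists [ffun j : 'I_N.+1 => nth k0 js j]; split.
  - split=> [j|j k jk]; rewrite !ffunE.
      rewrite (tnth_nth (event_type D k0)) alphaE (nth_map k0) ?js_sz //.
    apply: time_incr; apply: (pairwiseP k0 js_lt); rewrite // inE js_sz; exact: ltn_ord.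
  - by rewrite ffunE; have /andP[] := jsw ord0.
  - by rewrite ffunE; have /andP[] := jsw ord_max.
have hmono (j k : 'I_N.+1) : j <= k -> h j <= h k.
  rewrite leq_eqVlt => /orP[/eqP/val_inj->//|/hlt/ltnW]; by rewrite time_mono.
have hltn (j k : 'I_N.+1) : j < k -> h j < h k.
  by move/hlt; rewrite ltnNge time_mono -ltnNge.
pose js := [seq h j | j <- enum 'I_N.+1].
have -> : tval alpha = map (event_type D) js.
  rewrite -map_comp -[LHS]map_tnth_enum; apply: eq_map => j; exact/esym/hE.
apply: map_subseq.
(* Two strictly increasing lists with the same members are equal. *)
have -> : js = [seq k <- w | k \in js].
  apply: (irr_sorted_eq ord_trans) => [k|||k]; first exact: ltnn.
  - exact: (homo_sorted hltn) (sorted_enum_ord N.+1).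
  - exact/sorted_filter/sorted_infix_enum.
  - rewrite mem_filter; case: (boolP (k \in js)) => //= /mapP[j _ ->].
    rewrite mem_infix_enum (leq_trans ih) ?hmono //=.
    by rewrite (leq_ltn_trans _ hl) // hmono // leq_ord.
exact: filter_subseq.
Qed.

Lemma time_window_minimal w h : minimal_window alpha D w ->
  occurrence alpha D h -> subwindow (time_window D h) w -> time_window D h = w.
Proof.
move=> [_ wmin] hocc hw; apply: contrapT => neq.
by apply: (wmin (time_window D h)) => //; exists h; split=> //; split.
Qed.

Definition completed (l : 'I_n) := [exists i : 'I_n, [&& i <= l,
     ~~ subseq alpha (map fst (infix_word D i l))
   & subseq alpha (map fst (infix_word D i l.+1))]].

Lemma completedP (l : 'I_n) :
  completed l <-> exists2 w, minimal_window alpha D w & w.2 = time D l.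
Proof.
split=> [/existsP[i /and3P[il Ni Yi]]|[w mw wl]].
  pose P (j : 'I_n) := subseq alpha (map fst (infix_word D j l.+1)).
  have [j Pj jmax] := @arg_maxnP _ i P val Yi.
  have ij : i <= j by apply: jmax.
  have /subseq_occurrence[h [hocc jh hl]] := Pj.
  exists (time D j, time D l) => //; split.
    by exists h; split=> //; split; rewrite /= time_mono.
  move=> w' [[w'1 w'2] w'neq] [h' [hocc' [h'1 h'2]]]; apply: w'neq.
  rewrite /= in w'1 w'2 h'1 h'2.
  have jh' : j <= h' ord0 by rewrite -time_mono (leq_trans w'1).
  have h'l : h' ord_max <= l by rewrite -time_mono (leq_trans h'2).
  have h'j : h' ord0 <= j by apply: jmax; apply/subseq_occurrence; exists h'.
  (* An occurrence ending before l would lie in [i, l), against the choice of i. *)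
  have lh' : l <= h' ord_max.
    rewrite leqNgt; apply: contra Ni => h'l'; apply/subseq_occurrence; exists h'.
    by split=> //; apply: leq_trans jh'.
  move: h'j lh'; rewrite -!time_mono; case: w' w'1 w'2 h'1 h'2 => a b /=.
  by move=> *; congr pair; lia.
have windowE := time_window_minimal mw.
have [[h [hocc hw]] _] := mw.
have hl : h ord_max = l.
  apply/val_inj/eqP; rewrite eqn_leq -!time_mono -wl -(windowE _ hocc hw) /=.
  by rewrite leqnn.
have h0l : h ord0 <= l.
  (* In a one-node episode the first and last nodes coincide. *)
  rewrite -hl; case: (eqVneq (@ord0 N) ord_max) => [->//|neq].
  rewrite -time_mono ltnW //; apply: (proj2 hocc); by rewrite lt0n eq_sym.
(* The starting point is the left end of the window: an occurrence in [h ord0, l) would lie inside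
   [w] and end too early to fill it. *)
apply/existsP; exists (h ord0); apply/and3P; split=> //; last first.
  by apply/subseq_occurrence; exists h; rewrite hl.
apply/negP => /subseq_occurrence[h' [hocc' h0 hl']].
have hw' : subwindow (time_window D h') w.
  rewrite -(windowE _ hocc hw); split; rewrite /= time_mono //.
  by rewrite hl ltnW.
have := congr1 snd (windowE _ hocc' hw'); rewrite wl /= => tE.
by move: hl'; rewrite ltnNge -time_mono tE leqnn.
Qed.

(** Windows with a common right end are nested, so if distinct the inner one contradicts minimality
    of the outer. *)
Lemma minimal_window_end_inj w w' : minimal_window alpha D w ->
  minimal_window alpha D w' -> w.2 = w'.2 -> w = w'.
Proof.
wlog le_w : w w' / w.1 <= w'.1.
  by move=> W mw mw' e; case/orP: (leq_total w.1 w'.1) => le;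
     [|apply/esym]; apply: W.
move=> [_ wmin] [cw' _] e; apply: contrapT => neq.
by apply: (wmin w') => //; split=> [|/esym //]; split; rewrite ?e.
Qed.

Lemma minimal_occurrence_frequencyE :
  minimal_occurrence_frequency alpha D = #|completed|.
Proof.
rewrite /minimal_occurrence_frequency; set W := fset_set _.
have WE w : (w \in W) = `[< minimal_window alpha D w >].
  by rewrite in_fset_set ?inE //; exact: finite_minimal_windows.
(* Windows and completing events are both counted through the set of right-end times. *)
have <- : #|` [fset w.2 | w in W]%fset| = #|` W|.
  rewrite card_in_imfset // => w w'; rewrite !WE => /asboolP mw /asboolP mw'.
  exact: minimal_window_end_inj.
have -> : [fset w.2 | w in W]%fset = [fset time D l | l in enum completed]%fset.
  apply/fsetP => t; apply/imfsetP/imfsetP => /= [[w]|[l + ->]].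
    rewrite WE => /asboolP mw ->.
    have [[h [hocc hw]] _] := mw.
    have hE := time_window_minimal mw hocc hw.
    exists (h ord_max); last by rewrite -hE.
    by rewrite mem_enum; apply/completedP; exists w; rewrite // -hE.
  rewrite mem_enum => /completedP[w mw wl].
  by exists w; rewrite // WE; apply/asboolP.
rewrite card_in_imfset /= ?undup_id ?enum_uniq ?cardE // => l l' _ _ e.
by apply/val_inj/eqP; rewrite eqn_leq -!time_mono e leqnn.
Qed.

End Windows.

Theorem mainTheorem4 (A : finType) (n N : nat)
    (D : event_seq A n) (alpha : serial_episode A N.+1)
    (time_gt0 : forall i : 'I_n, 0 < time D i)
    (time_incr : forall i j : 'I_n, i < j -> time D i < time D j) :
  MO alpha D = minimal_occurrence_frequency alpha D.
Proof.
rewrite minimal_occurrence_frequencyE // MO_sum_completes // -sum1_card.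
rewrite [RHS]big_mkcond; apply: eq_bigr => l _.
have -> : (l \in completed alpha D) = completes alpha D l by rewrite completes_subseq.
by case: (completes _ _ _).
Qed.
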